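(* Let $m,n,k,l$ be integers with $0\le l\le k\le m\le n$ and $m\ge 1$, and let $X_1,\ldots,X_m,Y_1,\ldots,Y_n$ be continuous, independent and identically distributed random variables with values in a totally ordered space $(\Omega,<)$. Then $$\Pr\left(X^{((m))}<_{k,l}Y^{((n))}\right)=\frac{\#(m,n,k,l)}{\binom{m+n}{m}},$$ where $\#(m,n,k,l)$ is the number of lattice paths from $(0,0)$ to $(m,n)$ with $k$-horizontal exceedance equal to $l$.
   Context: Order statistics: $X^{(i)}$ denotes the $i$-th smallest value among $X_1,\ldots,X_m$, and $Y^{(i)}$ the $i$-th smallest value among $Y_1,\ldots,Y_n$. $X^{((m))}$ denotes the chain $X^{(1)}<X^{(2)}<\cdots<X^{(m)}$, and similarly $Y^{((n))}$. By definition, $X^{((m))}<_{k,l}Y^{((n))}$ holds iff $|\{i : 1\le i\le k \text{ and } X^{(i)}<Y^{(i)}\}|=l$. ''Continuous'' means the common distribution has no atoms ($\Pr[X_1=\omega]=0$ for every $\omega\in\Omega$), so that ties among the variables have probability $0$; $\Omega$ carries a $\sigma$-algebra for which $\{(a,b):a<b\}$ is measurable in $\Omega\times\Omega$ (e.g. $\Omega=\mathbb{R}$ with the Borel $\sigma$-algebra). Lattice paths: a lattice path starts at $(0,0)$ and takes unit steps $(1,0)$ (horizontal edges) and $(0,1)$ (vertical edges). The $k$-horizontal exceedance of a path ending at $(m,n)$ is the number of its first $k$ horizontal edges that lie below the line $y=x$ (a horizontal edge from $(a-1,c)$ to $(a,c)$ lies below $y=x$ iff $c\le a-1$). *)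

(* Defs.v *)
From HB Require Import structures.
From mathcomp Require Import all_boot all_order all_algebra.
From mathcomp Require Import all_classical all_reals all_analysis.

Set Implicit Arguments.
Unset Strict Implicit.
Unset Printing Implicit Defensive.

Import Order.TTheory GRing.Theory Num.Theory.

Local Open Scope classical_set_scope.

Section RandomVariables.
Context d dO (T : measurableType d) (Omega : measurableType dO) (R : realType)
  (P : probability T R).

Definition mutually_independent (I : finType) (Z : I -> {RV P >-> Omega}) :=
  forall (J : {set I}) (A : I -> set Omega),
    (forall i, i \in J -> measurable (A i)) ->
    P (\bigcap_(i in [set` J]) (Z i @^-1` A i)) =
      (\prod_(i in J) P (Z i @^-1` A i))%E.

Definition identically_distributed (I : Type) (Z : I -> {RV P >-> Omega}) :=
  forall i j (A : set Omega), measurable A ->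
    distribution P (Z i) A = distribution P (Z j) A.

Definition atomless (Z : {RV P >-> Omega}) :=
  forall omega : Omega, P [set t | Z t = omega] = 0%E.

Definition joint_family (I J : Type) (X : I -> {RV P >-> Omega})
    (Y : J -> {RV P >-> Omega}) (s : I + J) : {RV P >-> Omega} :=
  match s with inl i => X i | inr j => Y j end.

End RandomVariables.

(* The order is an explicit relation because no structure in the library joins
   [measurableType] and [orderType]. *)
Section OrderStatistics.
Context (T : eqType) (lt : rel T).

Definition strict_total_order : Prop :=
  [/\ irreflexive lt, transitive lt & forall x y, x != y -> lt x y || lt y x].

Definition refl_closure : rel T := fun x y => (x == y) || lt x y.

(* Indices start at 0: [order_stat x i] is the (i+1)-th smallest entry of x,
   counted with multiplicity. *)
Definition order_stat n (x : n.-tuple T) (i : 'I_n) : T :=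
  tnth (sort_tuple refl_closure x) i.

(* The relation x^((m)) <_{k,l} y^((n)). *)
Definition lt_kl m n (le_mn : m <= n) (k l : nat)
    (x : m.-tuple T) (y : n.-tuple T) : bool :=
  #|[pred i : 'I_m | (i < k) &&
      lt (order_stat x i) (order_stat y (widen_ord le_mn i))]| == l.

End OrderStatistics.

(* A lattice path from (0,0) is encoded by its sequence of steps: [true] is the
   horizontal step (1,0) and [false] the vertical step (0,1). *)
Section LatticePaths.

Definition path_point (p : seq bool) (j : nat) : nat * nat :=
  (count_mem true (take j p), count_mem false (take j p)).

Definition path_end (p : seq bool) : nat * nat := path_point p (size p).

(* The left endpoints (a-1, c) of the horizontal edges, in order of travel. *)
Definition horizontal_edges (p : seq bool) : seq (nat * nat) :=
  [seq path_point p j | j <- iota 0 (size p) & nth false p j].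

(* The edge from (a-1, c) to (a, c) lies below y = x iff c <= a-1. *)
Definition below_diagonal (e : nat * nat) : bool := e.2 <= e.1.

Definition horizontal_exceedance (k : nat) (p : seq bool) : nat :=
  count below_diagonal (take k (horizontal_edges p)).

(* The number #(m,n,k,l); a path from (0,0) to (m,n) has m + n steps. *)
Definition num_paths (m n k l : nat) : nat :=
  #|[pred p : (m + n).-tuple bool |
      (path_end p == (m, n)) && (horizontal_exceedance k p == l)]|.

End LatticePaths.

(* Main.v *)
(** Ties have probability zero, because by independence the law of a pair of the
variables is a product of atomless measures.  Otherwise a unique permutation [s]
of the [m + n] indices lists the variables in increasing order, and since the
joint law of an i.i.d. family does not depend on how the family is indexed, all
[(m + n)!] permutations are equally likely.  Reading the increasing list as a
word, with a horizontal step for each X and a vertical step for each Y, gives a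
uniformly distributed lattice path to [(m, n)].  The i-th horizontal edge of
that path lies below the diagonal iff fewer than i of the Y's precede
[X^(i)], that is, iff [X^(i) < Y^(i)].  *)

Require Import Defs.
From HB Require Import structures.
From mathcomp Require Import all_boot all_order all_algebra.
From mathcomp Require Import all_classical all_reals all_analysis.
From mathcomp Require Import fingroup perm.

Set Implicit Arguments.
Unset Strict Implicit.
Unset Printing Implicit Defensive.

Import Order.TTheory GRing.Theory Num.Theory.

Local Open Scope classical_set_scope.

(** * Positions of the steps of a word, and exceedance *)

(** Filtering keeps an initial segment of the naturals increasing, so the entries before the one of
    index [i] are exactly the smaller numbers satisfying [a]. *)
Lemma count_iota_nth_filter (a : pred nat) (N i : nat) :
  i < count a (iota 0 N) ->
  count a (iota 0 (nth 0 [seq j <- iota 0 N | a j] i)) = i.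
Proof.
elim: N => // N IH; rewrite -[N.+1]addn1 iotaD.
rewrite count_cat filter_cat nth_cat size_filter /=.
rewrite add0n addn0 => lti; case: ltnP => [/IH//|le_i].
move: lti; case: (a N); rewrite ?addn0 ?addn1 ?ltnS.
  move=> le_i'; have /eqP <- : count a (iota 0 N) == i by rewrite eqn_leq le_i.
  by rewrite subnn.
by rewrite ltnNge le_i.
Qed.

Lemma count_take_nth (b : bool) (w : seq bool) (j : nat) : j <= size w ->
  count_mem b (take j w) = count [pred x | nth false w x == b] (iota 0 j).
Proof. by move=> le_j; rewrite -(map_nth_iota0 false le_j) count_map. Qed.

(** Steps are recorded by their times, so that comparing an X with a Y becomes comparing two
    positions. *)
Definition step_positions (b : bool) (w : seq bool) : seq nat :=
  [seq j <- iota 0 (size w) | nth false w j == b].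

Lemma size_step_positions b w : size (step_positions b w) = count_mem b w.
Proof. by rewrite size_filter -[in RHS](take_size w) count_take_nth. Qed.

Lemma step_positions_nth b w i : i < count_mem b w ->
  let j := nth 0 (step_positions b w) i in
  [/\ j < size w, nth false w j = b & count_mem b (take j w) = i].
Proof.
rewrite -size_step_positions => lti j.
have: j \in step_positions b w by exact: mem_nth.
rewrite mem_filter mem_iota add0n => /andP[/eqP wj ltj]; split=> //.
rewrite count_take_nth 1?ltnW// count_iota_nth_filter//.
by move: lti; rewrite size_filter.
Qed.

Lemma horizontal_edgesE w :
  horizontal_edges w = [seq path_point w j | j <- step_positions true w].
Proof.
by congr map; apply: eq_filter => j; rewrite eqb_id.
Qed.

(** The horizontal edge of index [i] starts at abscissa [i], and its height counts the vertical
    steps made before it. This height is at most [i] iff the vertical step of index [i] is still to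
    come. *)
Lemma below_diagonal_positions w i :
  i < count_mem true w -> i < count_mem false w ->
  below_diagonal (nth (0, 0) (horizontal_edges w) i) =
    (nth 0 (step_positions true w) i < nth 0 (step_positions false w) i).
Proof.
move=> ltx lty.
have [] := step_positions_nth ltx; have [] := step_positions_nth lty.
rewrite horizontal_edgesE (nth_map 0) ?size_step_positions//.
set b := nth _ (step_positions false w) i.
set a := nth _ (step_positions true w) i.
move=> ltb wb cb lta wa ca.
rewrite /below_diagonal /= ca; case: ltngtP => [ltab|ltba|eqab]; last first.
- by move: wb; rewrite -eqab wa.
(* Before time [a] there are the [i] vertical steps preceding time [b], and also the one at [b]
   itself. *)
- apply/negbTE; rewrite -ltnNge -[in X in X < _]cb -(subnKC ltba) addSnnS takeD.
  rewrite count_cat -addn1 leq_add2l (drop_nth false ltb) subnSK//=.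
  by case: (a - b) (subn_gt0 b a) => [|c _]; rewrite ?ltba//= wb.
- by rewrite -[leqRHS]cb -(subnKC (ltnW ltab)) takeD count_cat leq_addr.
Qed.

Lemma card_ord_pred m (a : pred nat) :
  #|[pred i : 'I_m | a i]| = count a (iota 0 m).
Proof.
rewrite cardE size_filter -val_enum_ord count_map.
by rewrite enumT.
Qed.

Lemma count_take_iota (T : Type) (x0 : T) (a : pred T) (s : seq T) k :
  count a (take k s) =
    count (fun i => (i < k) && a (nth x0 s i)) (iota 0 (size s)).
Proof.
rewrite -{1}(mkseq_nth x0 s) /mkseq -map_take count_map take_iota.
rewrite -(filter_iota_ltn 0 (n := size s)) ?geq_minr//.
rewrite count_filter; apply: eq_in_count => i; rewrite mem_iota !add0n => lti.
by rewrite /= leq_min (andP lti).2 andbT andbC.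
Qed.

(** As [m <= n], each horizontal step has a vertical step of the same index, so no default value of
    [nth] enters the comparison. *)
Lemma horizontal_exceedanceE k w m n : count_mem true w = m ->
    count_mem false w = n -> m <= n ->
  horizontal_exceedance k w = #|[pred i : 'I_m | (i < k) &&
    (nth 0 (step_positions true w) i < nth 0 (step_positions false w) i)]|.
Proof.
move=> cm cn le_mn; rewrite (card_ord_pred m (fun i => (i < k) &&
  (nth 0 (step_positions true w) i < nth 0 (step_positions false w) i))).
rewrite /horizontal_exceedance (count_take_iota (0, 0)).
rewrite horizontal_edgesE size_map size_step_positions cm -horizontal_edgesE.
apply: eq_in_count => i; rewrite mem_iota add0n => /= lti.
by rewrite below_diagonal_positions ?cm ?cn// (leq_trans lti).
Qed.

(** * Words of permutations, and counting them *)

(* [s j] is the index of the (j+1)-th smallest variable; indices below [m] stand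
   for the X's. *)
Definition rank_word m n (s : 'S_(m + n)) : (m + n).-tuple bool :=
  [tuple s j < m | j < m + n].

(** Permutations compose from left to right, so a left factor only rearranges the letters. *)
Lemma rank_word_mul m n (s u : 'S_(m + n)) :
  rank_word (s * u) = [tuple tnth (rank_word u) (s j) | j < m + n].
Proof. by apply: eq_from_tnth => j; rewrite !tnth_mktuple permM. Qed.

Lemma perm_rank_word m n (s u : 'S_(m + n)) :
  perm_eq (rank_word s) (rank_word u).
Proof.
apply/tuple_permP; exists (s * u^-1)%g.
by rewrite -rank_word_mul mulgKV.
Qed.

Lemma count_rank_word m n (s : 'S_(m + n)) : count_mem true (rank_word s) = m.
Proof.
(* It suffices to treat the identity, whose word is [m] horizontal steps followed by [n] vertical
   ones. *)
rewrite (seq.permP (perm_rank_word s 1%g)) count_map.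
rewrite -(eq_count (a1 := preim val (gtn m))); last first.
  by move=> j; rewrite /= perm1 eqb_id.
rewrite -count_map val_enum_ord -size_filter.
by rewrite (filter_iota_ltn 0 (leq_addr n m)) size_iota.
Qed.

Lemma count_false (w : seq bool) :
  count_mem false w = size w - count_mem true w.
Proof.
by rewrite -(count_predC (pred1 true)) addKn; apply: eq_count; case.
Qed.

(** With two letters and a fixed length, the count of [true] makes [w] a rearrangement of the word
    of the identity; the rearranging permutation is the witness. *)
Lemma rank_word_surj m n (w : (m + n).-tuple bool) :
  count_mem true w = m -> exists s, w = rank_word s.
Proof.
move=> cw; have: perm_eq w (rank_word (1 : 'S_(m + n))).
  apply/allP => -[] _; apply/eqP; first by rewrite cw count_rank_word.
  by rewrite !count_false !size_tuple cw count_rank_word.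
by move=> /tuple_permP[s /val_inj ws]; exists s;
  rewrite ws -rank_word_mul mulg1.
Qed.

(** A word corresponds to the set of positions of its letters [true]. *)
Lemma card_words N m :
  #|[pred w : N.-tuple bool | count_mem true w == m]| = 'C(N, m).
Proof.
rewrite -[in RHS](card_ord N) -card_draws.
have cE (w : N.-tuple bool) : #|[set i | tnth w i]%SET| = count_mem true w.
  rewrite -[in RHS](map_tnth_enum w) count_map cardsE cardE size_filter.
  by rewrite enumT; apply: eq_count => i; rewrite /= eqb_id.
rewrite -(card_in_imset (f := fun w : N.-tuple bool => [set i | tnth w i]%SET)).
  apply: eq_card => A; rewrite !inE; apply/imsetP/idP => [[w]|/eqP cA].
    by rewrite inE => /eqP <- ->; rewrite cE.
  exists [tuple i \in A | i < N]; last first.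
    by apply/setP => i; rewrite inE tnth_mktuple.
  rewrite inE -cE -cA; apply/eqP/eq_card => i.
  by rewrite inE tnth_mktuple.
by move=> w v _ _ /setP wv; apply: eq_from_tnth => i;
  have := wv i; rewrite !inE.
Qed.

(* Left translation permutes the fibres of [rank_word] transitively, so they all
   have the same size. *)
Lemma card_rank_word m n (Q : pred ((m + n).-tuple bool)) :
  #|[pred s : 'S_(m + n) | Q (rank_word s)]| * 'C(m + n, m) =
  (m + n)`! * #|[pred w : (m + n).-tuple bool |
                  (count_mem true w == m) && Q w]|.
Proof.
pose c := #|[pred s : 'S_(m + n) | rank_word s == rank_word 1]|.
have fibre (w : (m + n).-tuple bool) : count_mem true w == m ->
    #|[pred s : 'S_(m + n) | rank_word s == w]| = c.
  move=> /eqP/rank_word_surj[s0 ->].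
  rewrite /c -!sum1_card [LHS](reindex_inj (mulgI s0)) /=; apply: eq_bigl => u.
  rewrite !inE -{2}(mulg1 s0) !rank_word_mul; apply/eqP/eqP => [E|->//].
  apply: eq_from_tnth => j; have := congr1 (fun t => tnth t (s0^-1 j)%g) E.
  by rewrite !tnth_mktuple permKV.
have card_Q (Q' : pred ((m + n).-tuple bool)) :
    #|[pred s : 'S_(m + n) | Q' (rank_word s)]| =
    #|[pred w : (m + n).-tuple bool | (count_mem true w == m) && Q' w]| * c.
  rewrite -sum1_card (partition_big (@rank_word m n)
    [pred w : (m + n).-tuple bool | (count_mem true w == m) && Q' w]);
    last first.
    by move=> s; rewrite !inE => ->; rewrite count_rank_word eqxx.
  rewrite -sum_nat_const; apply: eq_bigr => w /andP[cw Qw].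
  rewrite -(fibre _ cw) -sum1_card; apply: eq_bigl => s; rewrite !inE.
  by case: eqP => [->|_]; rewrite ?Qw ?andbF.
(* The always true predicate counts all permutations and thereby determines the fibre size [c]. *)
have -> : (m + n)`! = 'C(m + n, m) * c.
  rewrite -card_Sn -card_words.
  transitivity #|[pred s : 'S_(m + n) | predT (rank_word s)]|.
    exact: eq_card.
  by rewrite card_Q; congr (_ * c); apply: eq_card => w; rewrite !inE andbT.
by rewrite card_Q mulnC -mulnA; congr (_ * _); rewrite mulnC.
Qed.

Lemma num_pathsE m n k l :
  num_paths m n k l = #|[pred w : (m + n).-tuple bool |
    (count_mem true w == m) && (horizontal_exceedance k w == l)]|.
Proof.
apply: eq_card => w; rewrite !inE; congr (_ && _).
rewrite /path_end /path_point take_size xpair_eqE count_false size_tuple.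
by case: eqP => //= ->; rewrite addKn eqxx.
Qed.

(** * Order statistics and increasing chains *)

Section OrderStatisticsTheory.
Context (T : eqType) (lt : rel T) (lt_order : strict_total_order lt).

Let lt_irr : irreflexive lt. Proof. by case: lt_order. Qed.
Let lt_tr : transitive lt. Proof. by case: lt_order. Qed.
Let lt_total x y : x != y -> lt x y || lt y x.
Proof. by case: lt_order => _ _; apply. Qed.

Lemma lt_asym x y : lt x y -> lt y x = false.
Proof. by move=> xy; apply/negP => /(lt_tr xy); rewrite lt_irr. Qed.

Lemma refl_closureE x y : refl_closure lt x y = ~~ lt y x.
Proof.
rewrite /refl_closure; have [->|/lt_total/orP[xy|yx]] := eqVneq x y.
- by rewrite lt_irr.
- by rewrite xy lt_asym.
- by rewrite yx lt_asym.
Qed.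

Lemma refl_closure_total : total (refl_closure lt).
Proof.
move=> x y; rewrite !refl_closureE -negb_and.
by apply/negP => /andP[/lt_asym->].
Qed.

Lemma refl_closure_trans : transitive (refl_closure lt).
Proof.
move=> y x z /predU1P[->//|xy] /predU1P[<-|yz]; rewrite /refl_closure.
  by rewrite xy orbT.
by rewrite (lt_tr xy yz) orbT.
Qed.

Lemma refl_closure_anti : antisymmetric (refl_closure lt).
Proof.
move=> x y /andP[/predU1P[//|xy] /predU1P[//|yx]].
by rewrite lt_asym in yx.
Qed.

(** Sorting indices in place of values: the index selected depends only on the comparisons between
    entries. *)
Lemma order_stat_map (I : Type) (z : I -> T) n (f : 'I_n -> I) (i : 'I_n) :
  order_stat lt [tuple z (f j) | j < n] i =
  z (f (tnth (sort_tuple (fun a b => ~~ lt (z (f b)) (z (f a)))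
                         (ord_tuple n)) i)).
Proof.
rewrite -[RHS]/((z \o f) _) -tnth_map; congr tnth; apply: val_inj => /=.
rewrite sort_map; congr map; congr sort.
by apply/funext => a; apply/funext => b; rewrite /= refl_closureE.
Qed.

(** This makes the event a function of the pattern of comparisons, from which its measurability will
    follow. *)
Lemma eq_lt_kl (I : Type) (z z' : I -> T) m n (le_mn : m <= n) k l
    (f : 'I_m -> I) (g : 'I_n -> I) :
  (forall i j, lt (z i) (z j) = lt (z' i) (z' j)) ->
  lt_kl lt le_mn k l [tuple z (f i) | i < m] [tuple z (g j) | j < n] =
  lt_kl lt le_mn k l [tuple z' (f i) | i < m] [tuple z' (g j) | j < n].
Proof.
move=> zz'; rewrite /lt_kl; congr (_ == l); apply: eq_card => i; rewrite !inE.
have sortE p (h : 'I_p -> I) :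
    (fun a b => ~~ lt (z (h b)) (z (h a))) =
    (fun a b => ~~ lt (z' (h b)) (z' (h a))).
  by apply/funext => a; apply/funext => b; rewrite zz'.
by rewrite !order_stat_map !sortE zz'.
Qed.

Definition is_chain N (z : 'I_N -> T) (s : 'S_N) : Prop :=
  forall i j : 'I_N, i < j -> lt (z (s i)) (z (s j)).

Section Chain.
Context (N : nat) (z : 'I_N -> T) (s : 'S_N).
Hypothesis chain : is_chain z s.

Lemma lt_chain (i j : 'I_N) : lt (z (s i)) (z (s j)) = (i < j).
Proof.
case: ltngtP => [/chain//|/chain/lt_asym//|/val_inj ->].
exact: lt_irr.
Qed.

(** A sorted list is determined by its contents. Selecting ranks by [p] lets one statement sort the
    X's, the Y's or all variables. *)
Lemma sort_chain (r : seq 'I_N) (p : pred 'I_N) :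
  perm_eq r [seq s j | j <- enum 'I_N & p j] ->
  sort (refl_closure lt) [seq z i | i <- r] =
  [seq z (s j) | j <- enum 'I_N & p j].
Proof.
move=> rs; apply: (sorted_eq refl_closure_trans refl_closure_anti).
- exact: (sort_sorted refl_closure_total).
- apply: (homo_sorted (e := fun i j : 'I_N => i < j)).
    by move=> i j ij; rewrite /refl_closure lt_chain ij orbT.
  apply: sorted_filter; first by move=> ? ? ?; exact: ltn_trans.
  have : sorted ltn (map val (enum 'I_N)).
    by rewrite val_enum_ord iota_ltn_sorted.
  by rewrite sorted_map.
- by rewrite perm_sort (map_comp z s) perm_map.
Qed.

End Chain.

Lemma is_chain_inj N (z : 'I_N -> T) (s : 'S_N) : is_chain z s -> injective z.
Proof.
move=> chain i j; rewrite -(permKV s i) -(permKV s j) => zij.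
congr (s _); apply/val_inj; case: (ltngtP ((s^-1)%g i) ((s^-1)%g j)) => //.
  by move/chain; rewrite zij lt_irr.
by move/chain; rewrite zij lt_irr.
Qed.

(** Both permutations produce the sorted list of all values, and the values are distinct. *)
Lemma is_chain_unique N (z : 'I_N -> T) (s u : 'S_N) :
  is_chain z s -> is_chain z u -> s = u.
Proof.
move=> chs chu; apply/permP => j; apply: (is_chain_inj chs).
have perm_enum (v : 'S_N) :
    perm_eq (enum 'I_N) [seq v i | i <- enum 'I_N & predT i].
  rewrite filter_predT; apply: uniq_perm;
    rewrite ?(map_inj_uniq perm_inj) ?enum_uniq//.
  by move=> i; rewrite -(permKV v i) (mem_map perm_inj) !mem_enum.
have : [seq z (s i) | i <- enum 'I_N] = [seq z (u i) | i <- enum 'I_N].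
  have := sort_chain chu (perm_enum u); rewrite (sort_chain chs (perm_enum s)).
  by rewrite filter_predT.
by move/eq_in_map => /(_ j); rewrite mem_enum; apply.
Qed.

Lemma is_chain_exists N (z : 'I_N -> T) :
  injective z -> exists s : 'S_N, is_chain z s.
Proof.
move=> z_inj; pose leZ := relpre z (refl_closure lt).
have /tuple_permP[s sE] : perm_eq (sort leZ (ord_tuple N)) (ord_tuple N).
  by rewrite perm_sort.
exists s => i j ltij.
have sij (h : 'I_N) : s h = nth i (sort leZ (ord_tuple N)) h.
  by rewrite sE -tnth_nth tnth_mktuple tnth_ord_tuple.
have leZ_tr : transitive leZ by move=> ? ? ?; exact: refl_closure_trans.
have leZ_total : total leZ by move=> ? ?; exact: refl_closure_total.
have : leZ (s i) (s j).
  rewrite !sij.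
  apply: (sorted_ltn_nth leZ_tr i (sort_sorted leZ_total _)) => //.
  - by rewrite inE size_sort size_tuple.
  - by rewrite inE size_sort size_tuple.
(* Sorting gives only the weak order; injectivity excludes equality at two different ranks. *)
by case/predU1P => // /z_inj/perm_inj ij; rewrite ij ltnn in ltij.
Qed.

(** * From order statistics on a chain to the rank word *)

Section OrderStatChain.
Context (m n : nat) (z : 'I_(m + n) -> T) (s : 'S_(m + n)).
Hypothesis chain : is_chain z s.

Let ranks (b : bool) :=
  [seq j : 'I_(m + n) <- enum 'I_(m + n) | (s j < m) == b].

Let val_ranks b : map val (ranks b) = step_positions b (rank_word s).
Proof.
rewrite /step_positions size_tuple -val_enum_ord filter_map; congr map.
apply: eq_filter => j.
by rewrite -(tnth_mktuple (fun j => s j < m)) (tnth_nth false).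
Qed.

(** Here [f] lists the indices of one sample. Sorted, that sample is read off along the ranks it
    occupies, which are the step positions of its letter. *)
Let order_stat_chain (b : bool) p (f : 'I_p -> 'I_(m + n)) (i : 'I_p)
    (j0 : 'I_(m + n)) :
  perm_eq [seq f j | j <- enum 'I_p] [seq s j | j <- ranks b] ->
  exists2 j : 'I_(m + n), j = nth 0 (step_positions b (rank_word s)) i :> nat &
    order_stat lt [tuple z (f j) | j < p] i = z (s j).
Proof.
move=> frank; have sz : size (ranks b) = p.
  by have := perm_size frank; rewrite size_map size_enum_ord size_map.
exists (nth j0 (ranks b) i).
  by rewrite -val_ranks (nth_map j0) ?sz.
rewrite /order_stat (tnth_nth (z j0)) /=.
rewrite (map_comp z f) (sort_chain chain frank).
by rewrite (nth_map j0) ?sz.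
Qed.

Let perm_lshift :
  perm_eq [seq lshift n j | j <- enum 'I_m] [seq s j | j <- ranks true].
Proof.
apply: uniq_perm.
- by rewrite (map_inj_uniq (@lshift_inj _ _)) enum_uniq.
- by rewrite (map_inj_uniq perm_inj) filter_uniq ?enum_uniq.
move=> i; apply/mapP/mapP => [[j _ ->]|[j]].
  exists ((s^-1)%g (lshift n j)); rewrite ?permKV//.
  by rewrite mem_filter mem_enum permKV /= ltn_ord.
rewrite mem_filter eqb_id => /andP[ltj _] ->.
by exists (Ordinal ltj); rewrite ?mem_enum//; apply: val_inj.
Qed.

Let perm_rshift :
  perm_eq [seq rshift m j | j <- enum 'I_n] [seq s j | j <- ranks false].
Proof.
apply: uniq_perm.
- by rewrite (map_inj_uniq (@rshift_inj _ _)) enum_uniq.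
- by rewrite (map_inj_uniq perm_inj) filter_uniq ?enum_uniq.
move=> i; apply/mapP/mapP => [[j _ ->]|[j]].
  exists ((s^-1)%g (rshift m j)); rewrite ?permKV//.
  by rewrite mem_filter mem_enum permKV /= eqbF_neg -leqNgt leq_addr.
rewrite mem_filter eqbF_neg -leqNgt => /andP[lej _] ->.
have ltj : s j - m < n by rewrite ltn_subLR.
by exists (Ordinal ltj); rewrite ?mem_enum//; apply: val_inj; rewrite /= subnKC.
Qed.

(** Along a chain, comparing values is comparing ranks, hence comparing the positions of a
    horizontal and a vertical step of equal index. *)
Lemma lt_kl_chain (le_mn : m <= n) k l :
  lt_kl lt le_mn k l [tuple z (lshift n i) | i < m]
    [tuple z (rshift m j) | j < n] =
  (horizontal_exceedance k (rank_word s) == l).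
Proof.
have cm := count_rank_word s.
have cn : count_mem false (rank_word s) = n.
  by rewrite count_false cm size_tuple addKn.
rewrite (horizontal_exceedanceE k cm cn le_mn); congr (_ == l).
apply: eq_card => i; rewrite !inE; congr (_ && _).
have [a ea ->] := order_stat_chain i (lshift n i) perm_lshift.
have [b eb ->] := order_stat_chain (widen_ord le_mn i) (lshift n i) perm_rshift.
by rewrite (lt_chain chain) ea eb.
Qed.

End OrderStatChain.
End OrderStatisticsTheory.

(** * Uniqueness of the joint law of independent variables *)

Section JointLaw.
Context d dO (T : measurableType d) (Omega : measurableType dO) (R : realType)
  (P : probability T R).

(** Generators of the product sigma-algebra on [K -> Omega]. *)
Definition rectangles (K : Type) : set (set (K -> Omega)) :=
  [set S | exists2 A : K -> set Omega, forall k, measurable (A k) &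
    S = [set z | forall k, A k (z k)]].
Arguments rectangles : clear implicits.

Lemma setI_closed_rectangles K : setI_closed (rectangles K).
Proof.
move=> _ _ [A mA ->] [B mB ->]; exists (fun k => A k `&` B k).
  by move=> k; exact: measurableI.
apply/seteqP; split=> z /=.
  by move=> [Az Bz] k; split; [exact: Az|exact: Bz].
by move=> ABz; split=> k; have [] := ABz k.
Qed.

Lemma measurable_coord K (k : K) :
  measurable_fun setT (fun z : g_sigma_algebraType (rectangles K) => z k).
Proof.
move=> _ A mA; rewrite setTI; apply: sub_sigma_algebra.
(* The cylinder over [A] at [k]; the implication avoids deciding equality in an arbitrary type
   [K]. *)
pose B k' := [set x : Omega | k' = k -> A x].
exists B => [k'|].
  have [->|k'k] := pselect (k' = k).
    rewrite [X in measurable X](_ : _ = A)//.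
    by apply/seteqP; split=> x /= Ax; first exact: Ax.
  rewrite [X in measurable X](_ : _ = setT)//.
  by apply/seteqP; split=> x // _ /k'k.
apply/seteqP; split=> z /=; first by move=> Az k' ->.
by move=> /(_ k); apply.
Qed.

(** An intersection over [J] is one over the image of [J], with the sets transported by [g]. This
    serves both to permute the variables and to renumber the joint family. *)
Lemma mutually_independent_inj (I K : finType) (Z : I -> {RV P >-> Omega})
    (f : K -> I) (g : I -> K) : cancel f g ->
  mutually_independent Z -> mutually_independent (Z \o f).
Proof.
move=> fK indep J A mA; have f_inj := can_inj fK.
have := indep (f @: J)%SET (A \o g).
rewrite big_imset /=; last by move=> ? ? _ _ /f_inj.
under eq_bigr do rewrite fK.
rewrite (_ : \bigcap_(i in [set` (f @: J)%SET]) _ =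
  \bigcap_(i in [set` J]) (Z (f i) @^-1` A i)); last first.
  apply/seteqP; split=> t /= tA i.
    by move=> iJ; have := tA (f i); rewrite /= fK; apply; exact: imset_f.
  by move=> /imsetP[k kJ ->]; rewrite /= fK; exact: tA.
by apply=> i /imsetP[k kJ ->]; rewrite /= fK; exact: mA.
Qed.

(** Independence makes the two laws agree on rectangles, which are closed under intersection; Dynkin
    induction extends the agreement. *)
Lemma joint_law_unique (K : finType) (Z W : K -> {RV P >-> Omega}) :
    mutually_independent Z -> mutually_independent W ->
    (forall k A, measurable A -> P (Z k @^-1` A) = P (W k @^-1` A)) ->
  forall S : set (g_sigma_algebraType (rectangles K)), measurable S ->
    measurable ((fun t k => Z k t) @^-1` S) /\
    P ((fun t k => Z k t) @^-1` S) = P ((fun t k => W k t) @^-1` S).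
Proof.
move=> indZ indW ZW S mS.
(* Measurability of both preimages is carried along, since the steps for complements and unions use
   it. *)
pose law_eq (S : set (g_sigma_algebraType (rectangles K))) :=
  [/\ measurable ((fun t k => Z k t) @^-1` S),
    measurable ((fun t k => W k t) @^-1` S) &
    P ((fun t k => Z k t) @^-1` S) = P ((fun t k => W k t) @^-1` S)].
suff [mZ _ PS] : law_eq S by split.
move: S mS.
have rectE (V : K -> {RV P >-> Omega}) (A : K -> set Omega) :
    (fun t k => V k t) @^-1` [set z | forall k, A k (z k)] =
    \bigcap_(k in [set` [set: K]%SET]) (V k @^-1` A k).
  apply/seteqP; split=> t /= tA k; first by move=> _; exact: tA.
  by apply: tA; rewrite /= finset.in_setT.
apply: (@dynkin_induction _ (g_sigma_algebraType (rectangles K))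
  (rectangles K) law_eq erefl); rewrite {}/law_eq.
- exact: setI_closed_rectangles.
- by split; rewrite !preimage_setT.
- move=> _ [A mA ->]; rewrite !rectE; split.
  + by apply: fin_bigcap_measurable => // k _; exact: measurable_funPTI.
  + by apply: fin_bigcap_measurable => // k _; exact: measurable_funPTI.
  + rewrite indZ// indW//; apply: eq_bigr => k _; exact: ZW.
- move=> S mS [mZ mW PS]; split.
  + by rewrite -preimage_setC; exact: measurableC.
  + by rewrite -preimage_setC; exact: measurableC.
  + by rewrite -!preimage_setC !probability_setC ?PS.
- move=> F mF tF PF; rewrite !preimage_bigcup; split.
  + by apply: bigcup_measurable => i _; have [] := PF i.
  + by apply: bigcup_measurable => i _; have [] := PF i.
  have tr (V : K -> {RV P >-> Omega}) :
      trivIset setT (fun i => (fun t k => V k t) @^-1` F i).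
    apply/trivIsetP => i j _ _ ij; move/trivIsetP : tF => tF.
    by rewrite -preimage_setI tF// preimage_set0.
  rewrite !measure_bigcup//; try by move=> i _; have [] := PF i.
  by apply: eq_eseriesr => i _; have [] := PF i.
Qed.

End JointLaw.

(** * Null ties and equally likely rankings *)

Section Ranking.
Context d dO (T : measurableType d) (Omega : measurableType dO) (R : realType)
  (P : probability T R).
Context (lt : rel Omega) (lt_order : strict_total_order lt).
Hypothesis lt_meas : measurable [set ab : Omega * Omega | lt ab.1 ab.2].

Lemma measurable_lt dU (U : measurableType dU) (f g : U -> Omega) :
  measurable_fun setT f -> measurable_fun setT g ->
  measurable [set u | lt (f u) (g u)].
Proof.
move=> mf mg; have := measurable_fun_pair mf mg measurableT lt_meas.
by rewrite setTI.
Qed.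

(** Totality turns equality into the failure of both comparisons, so measurability passes from the
    order to the diagonal. *)
Lemma setC_lt_eq (U : Type) (f g : U -> Omega) :
  [set u | f u = g u] =
    ~` [set u | lt (f u) (g u)] `&` ~` [set u | lt (g u) (f u)].
Proof.
have [irr _ tot] := lt_order.
apply/seteqP; split=> u /= => [->|[/negP fg /negP gf]]; first by rewrite irr.
by apply/eqP; apply: contraNT fg => /tot; rewrite (negbTE gf) orbF.
Qed.

Lemma measurable_eq dU (U : measurableType dU) (f g : U -> Omega) :
  measurable_fun setT f -> measurable_fun setT g ->
  measurable [set u | f u = g u].
Proof.
move=> mf mg; rewrite setC_lt_eq.
by apply: measurableI; apply: measurableC; exact: measurable_lt.
Qed.

(* Such an event is a finite union of the cells on which all pairwise
   comparisons are prescribed. *)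
Lemma measurable_order_event (I : finType) (Z : I -> {RV P >-> Omega})
    (E : set T) :
  (forall t u, (forall i j, lt (Z i t) (Z j t) = lt (Z i u) (Z j u)) ->
    E t -> E u) -> measurable E.
Proof.
move=> Elt; pose cmp t := [ffun p : I * I => lt (Z p.1 t) (Z p.2 t)].
have mcmp c : measurable (cmp @^-1` [set c]).
  rewrite [X in measurable X](_ : _ = \bigcap_(p in [set: I * I])
      [set t | lt (Z p.1 t) (Z p.2 t) = c p]).
    apply: fin_bigcap_measurable => [|p _]; first exact: finite_finset.
    have mlt : measurable [set t | lt (Z p.1 t) (Z p.2 t)].
      by apply: measurable_lt; exact: measurable_funPT.
    case: (c p); first exact: mlt.
    rewrite [X in measurable X](_ : _ = ~` [set t | lt (Z p.1 t) (Z p.2 t)]).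
      exact: measurableC.
    by apply/seteqP; split=> t /= => [->|/negP/negbTE].
  apply/seteqP; split=> t /=.
    by move=> <- p _; rewrite /= ffunE.
  by move=> tc; apply/ffunP => p; rewrite ffunE; exact: tc.
(* Being invariant under equal patterns, [E] is the union of the cells it meets. *)
rewrite (_ : E = \bigcup_(c in [set c | exists2 t, E t & cmp t = c])
    cmp @^-1` [set c]).
  by apply: fin_bigcup_measurable => [|c _]; [exact: finite_finset|exact: mcmp].
apply/seteqP; split=> [t Et|u [_ [t Et <-]] /= cmpE].
  by exists (cmp t) => //; exists t.
apply: Elt Et => i j; move/ffunP/(_ (i, j)): cmpE.
by rewrite !ffunE.
Qed.

(* The joint law of two of the variables is a product measure, and the sections
   of the diagonal are singletons. *)
Lemma probability_tie (I : finType) (Z : I -> {RV P >-> Omega}) (i j : I) :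
  mutually_independent Z -> atomless (Z j) -> i != j ->
  P [set t | Z i t = Z j t] = 0%E.
Proof.
move=> indep cont ij.
have mZ k : measurable_fun setT (Z k) by exact: measurable_funPT.
have mpair : (fun t => (Z i t, Z j t)) \in @mfun _ _ T (Omega * Omega)%type.
  by apply/mem_set; exact: measurable_fun_pair.
pose diag := [set ab : Omega * Omega | ab.1 = ab.2].
have mdiag : measurable diag by exact: measurable_eq.
have pairE A B : measurable A -> measurable B ->
    distribution P (mfun_Sub mpair) (A `*` B) =
    (distribution P (Z i) A * distribution P (Z j) B)%E.
  (* Independence is applied to the pair [i], [j], with [A] placed at [i] and [B] at [j]. *)
  move=> mA mB; have := indep [set i; j]%SET (fun k => if k == i then A else B).
  rewrite big_setU1 ?inE//= big_set1 eqxx (eq_sym j) (negbTE ij).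
  rewrite /distribution /pushforward => <- => [|k _]; last by case: ifP.
  congr (P _); apply/seteqP; split=> t /=.
    move=> [At Bt] k; rewrite /= !inE.
    by case: eqP => [-> //|_ /=/eqP ->].
  move=> tAB; split.
    by have := tAB i; rewrite /= !inE !eqxx; exact.
  by have := tAB j; rewrite /= !inE eqxx orbT eq_sym (negbTE ij); exact.
rewrite -[LHS]/(distribution P (mfun_Sub mpair) diag).
rewrite -(product_measure_unique pairE mdiag).
rewrite /= /product_measure1; apply: integral0_eq => a _ /=.
rewrite /distribution /pushforward -[RHS](cont a); congr (P _).
by apply/seteqP; split=> t; rewrite /xsection /= in_setE /diag /=.
Qed.

Section Chains.
Context (N : nat) (Z : 'I_N -> {RV P >-> Omega}).
Hypothesis indep : mutually_independent Z.
Hypothesis ident : identically_distributed Z.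
Hypothesis cont : forall i, atomless (Z i).

Let chain (s : 'S_N) : set T := [set t | is_chain lt (Z ^~ t) s].

(** The event of ranking [s] is the preimage of one fixed set [S] under the family [Z \o s], and all
    permuted families share one joint law. *)
Let measurable_probability_chain s :
  measurable (chain s) /\ P (chain s) = P (chain 1%g).
Proof.
pose S := [set z : g_sigma_algebraType (@rectangles _ Omega 'I_N) |
  forall i j : 'I_N, i < j -> lt (z i) (z j)].
have mS : measurable S.
  rewrite [X in measurable X](_ : _ =
      \bigcap_(p in [set p : 'I_N * 'I_N | p.1 < p.2])
        [set z | lt (z p.1) (z p.2)]).
    apply: fin_bigcap_measurable => // p _.
    by apply: measurable_lt; exact: measurable_coord.
  apply/seteqP; split=> z /= zlt => [[i j]|i j] /=;
    by [exact: zlt|exact: (zlt (i, j))].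
have ind u : mutually_independent (Z \o (u : 'S_N)).
  exact: (mutually_independent_inj (permK u) indep).
have := joint_law_unique (ind s) (ind 1%g) _ mS.
by apply=> k A mA; exact: ident.
Qed.

Let measurable_chain s : measurable (chain s).
Proof. by case: (measurable_probability_chain s). Qed.

Let probability_chain s : P (chain s) = (fine (P (chain 1%g)))%:E.
Proof.
have [_ ->] := measurable_probability_chain s.
by rewrite fineK//; exact: fin_num_measure.
Qed.

Let chains (Q : pred 'S_N) : set T := \bigcup_(s in [set` Q]) chain s.

Let measurable_chains Q : measurable (chains Q).
Proof. by apply: fin_bigcup_measurable => // s _; exact: measurable_chain. Qed.

(** Uniqueness of the ranking makes the chain events disjoint, so their equal probabilities add
    up. *)
Let probability_chains Q :
  P (chains Q) = (fine (P (chain 1%g)) *+ #|Q|)%:E.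
Proof.
rewrite /chains measure_fin_bigcup//; last first.
  by move=> s u _ _ [t [ts tu]]; exact: (is_chain_unique lt_order ts tu).
rewrite -(bigfs _ (index_enum_uniq _))//; last first.
  by move=> s _; rewrite mem_index_enum.
rewrite (eq_bigr _ (fun s _ => probability_chain s)).
by rewrite sumEFin sumr_const.
Qed.

(** Off the chains two variables tie, so finitely many null events cover the complement. *)
Let chains_full : P (~` chains predT) = 0%E.
Proof.
apply/eqP; rewrite eq_le measure_ge0 andbT.
have mtie (p : 'I_N * 'I_N) : measurable [set t | Z p.1 t = Z p.2 t].
  by apply: measurable_eq; exact: measurable_funPT.
rewrite [leRHS](_ : _ = \sum_(p \in [set p : 'I_N * 'I_N | p.1 != p.2])
    P [set t | Z p.1 t = Z p.2 t])%E; last first.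
  by rewrite fsbig1// => p /= ij; exact: probability_tie.
apply: content_sub_fsum.
- exact: finite_finset.
- by move=> p _; exact: mtie.
- by apply: measurableC; exact: measurable_chains.
move=> t nochain; apply: contrapT => notie; apply: nochain.
have Zinj : injective (Z ^~ t).
  move=> i j Zij; apply/eqP; apply: contrapT => /negP ij.
  by apply: notie; exists (i, j).
by have [s cs] := is_chain_exists lt_order Zinj; exists s.
Qed.

Lemma probability_ranking (Q : pred 'S_N) (E : set T) : measurable E ->
    (forall s t, is_chain lt (Z ^~ t) s -> E t <-> Q s) ->
  P E = (#|Q|%:R / (N`!)%:R)%:E.
Proof.
move=> mE EQ; have PE : P E = P (chains Q).
  (* The part of [E] outside all chains is null; inside, [EQ] identifies [E] with the chains of
     [Q]. *)
  rewrite (measureDI P mE (measurable_chains predT)).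
  rewrite [X in (X + _)%E](_ : _ = 0%E) ?add0e.
    congr (P _); apply/seteqP; split=> t.
      by move=> [Et [s _ ts]]; exists s => //; apply/(EQ s t ts).
    by move=> [s Qs ts]; split; [apply/(EQ s t ts)|exists s].
  apply: (subset_measure0 _ _ _ chains_full).
  - exact: measurableD.
  - exact: measurableC.
  - by move=> t [].
(* All [N]! chains together have probability one, which fixes their common probability [p]. *)
have := chains_full; rewrite probability_setC// PE !probability_chains card_Sn.
move: (fine _) (fact_gt0 N) => p; move: N`! => F F_gt0.
rewrite -EFinB => -[/eqP]; rewrite subr_eq0 => /eqP p1.
have F_neq0 : (F%:R != 0 :> R)%R by rewrite pnatr_eq0 -lt0n.
have -> : (p = F%:R^-1)%R by apply: (mulfI F_neq0); rewrite mulr_natl -p1 divff.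
by rewrite mulr_natl.
Qed.

End Chains.
End Ranking.

(** * From uniform rankings to the proportion of lattice paths *)

Theorem theorem3p4 (R : realType) (d : measure_display) (T : measurableType d)
    (P : probability T R)
    (dO : measure_display) (Omega : measurableType dO)
    (lt : rel Omega) (lt_order : strict_total_order lt)
    (lt_meas : measurable [set ab : Omega * Omega | lt ab.1 ab.2])
    (m n k l : nat) (le_lk : l <= k) (le_km : k <= m) (le_mn : m <= n)
    (m_ge1 : 1 <= m)
    (X : 'I_m -> {RV P >-> Omega}) (Y : 'I_n -> {RV P >-> Omega})
    (indep : mutually_independent (joint_family X Y))
    (ident : identically_distributed (joint_family X Y))
    (cont : forall s, atomless (joint_family X Y s)) :
  P [set t | lt_kl lt le_mn k l [tuple X i t | i < m] [tuple Y j t | j < n]] =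
    ((num_paths m n k l)%:R / ('C(m + n, m))%:R)%:E.
Proof.
(* A single numbering, with the X's first, matching the convention of [rank_word]. *)
pose Z (i : 'I_(m + n)) := joint_family X Y (fintype.split i).
have indepZ : mutually_independent Z.
  exact: (mutually_independent_inj (@splitK m n) indep).
have ZE t : lt_kl lt le_mn k l [tuple X i t | i < m] [tuple Y j t | j < n] =
    lt_kl lt le_mn k l [tuple Z (lshift n i) t | i < m]
      [tuple Z (rshift m j) t | j < n].
  congr (lt_kl _ _ _ _ _ _); apply: eq_from_tnth => i; rewrite !tnth_mktuple /Z.
    by rewrite (unsplitK (inl i)).
  by rewrite (unsplitK (inr i)).
pose Q := [pred s : 'S_(m + n) | horizontal_exceedance k (rank_word s) == l].
rewrite (probability_ranking lt_order lt_meas indepZ _ _ (Q := Q)).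
- have := card_rank_word
    (fun w : (m + n).-tuple bool => horizontal_exceedance k w == l).
  rewrite -num_pathsE -/Q => cardQ; congr (_%:E).
  have fact_neq0 : ((m + n)`!%:R != 0 :> R)%R.
    by rewrite pnatr_eq0 -lt0n fact_gt0.
  have bin_neq0 : ('C(m + n, m)%:R != 0 :> R)%R.
    by rewrite pnatr_eq0 -lt0n bin_gt0 leq_addr.
  (* Cross-multiplied, the two fractions agree by the count of permutations over paths. *)
  by apply/eqP; rewrite eqr_div// -!natrM cardQ mulnC.
- by move=> i j A mA; exact: ident.
- by move=> i; exact: cont.
- apply: (measurable_order_event lt_meas (Z := Z)) => t u tu /=; rewrite !ZE.
  by rewrite (eq_lt_kl lt_order le_mn k l _ _ tu).
- by move=> s t ts; rewrite /= ZE (lt_kl_chain lt_order ts).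
Qed.
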